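(* Let $\{X_{\mathtt{i}}:\mathtt{i}\in I^*\}$ be a weakly controlled Moran construction in a metric space $M$. Let $c,r_0>0$ and $\alpha_1\ge\alpha_2>0$ be constants. (a) If for every $x\in M$ and $0<r<R<r_0$, and for every maximal $r$-packing $\{B(y,r):y\in H\}$ of $B(x,R)$, we have $\#H<c\left(\frac Rr\right)^{\alpha_1}$, then the ball condition implies the finite clustering property. (b) If, on the other hand, for every $x\in M$ and $0<r<R<r_0$, and for every maximal $r$-packing $\{B(y,r):y\in H\}$ of $B(x,R)$, we have $\#H>c^{-1}\left(\frac Rr\right)^{\alpha_2}$, then the finite clustering property implies the ball condition.
   Context: Balls $B(x,r)=\{y\in M:d(x,y)<r\}$ are open. For $A\subset M$ and $r>0$, a collection $\{B(y,r):y\in H\}$ is an $r$-packing of $A$ if $H\subset A$ and $B(y,r)\cap B(z,r)=\emptyset$ for all distinct $y,z\in H$; it is maximal if $A\subset\bigcup_{y\in H}B(y,2r)$. Words: $I$ is an index set with $2\le\#I<\infty$; $I^*=\bigcup_{n\ge1}I^n$, $I^\infty=I^{\mathbb{N}}$; $\mathtt{i}\mathtt{j}$ is concatenation; $\mathtt{i}|_n$ is the initial segment of length $n$; $\mathtt{i}^-=\mathtt{i}|_{|\mathtt{i}|-1}$ (for $|\mathtt{i}|\ge2$; conditions involving $\mathtt{i}^-$ concern such words). Weakly controlled Moran construction (WCMC): a collection $\{X_{\mathtt{i}}:\mathtt{i}\in I^*\}$ of compact subsets of $M$ with positive diameter for which there is $D\ge1$ such that for all $\mathtt{i},\mathtt{j}\in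 I^*$: (W1) $X_{\mathtt{i}}\subset X_{\mathtt{i}^-}$; (W2) there is $n\in\mathbb{N}$ with $\max_{\mathtt{i}\in I^n}\operatorname{diam}(X_{\mathtt{i}})<D^{-1}$; (W3) $\operatorname{diam}(X_{\mathtt{i}\mathtt{j}})\le D\operatorname{diam}(X_{\mathtt{i}})\operatorname{diam}(X_{\mathtt{j}})$; (W4) $\operatorname{diam}(X_{\mathtt{i}})\ge D^{-1}\operatorname{diam}(X_{\mathtt{i}^-})$. Its limit set is $E=\pi(I^\infty)$ where $\{\pi(\mathtt{i})\}=\bigcap_{n\ge1}X_{\mathtt{i}|_n}$. $Z(r)=\{\mathtt{i}\in I^*:\operatorname{diam}(X_{\mathtt{i}})\le r<\operatorname{diam}(X_{\mathtt{i}^-})\}$ and $Z(x,r)=\{\mathtt{i}\in Z(r):X_{\mathtt{i}}\cap B(x,r)\neq\emptyset\}$. Finite clustering property: $\sup_{x\in E}\limsup_{r\downarrow0}\#Z(x,r)<\infty$. Ball condition: there is $0<\delta<1$ such that for every $x\in E$ there is $r_x>0$ so that for every $0<r<r_x$ there are points $x_{\mathtt{i}}\in M$, $\mathtt{i}\in Z(x,r)$, with $\operatorname{dist}(x_{\mathtt{i}},X_{\mathtt{i}})<r$ and with the balls $B(x_{\mathtt{i}},\delta r)$, $\mathtt{i}\in Z(x,r)$, pairwise disjoint. *)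

(* Defs.v *)
From HB Require Import structures.
From mathcomp Require Import all_boot all_order all_algebra.
From mathcomp Require Import all_classical all_reals all_analysis.

Set Implicit Arguments.
Unset Strict Implicit.
Unset Printing Implicit Defensive.

Import Order.TTheory GRing.Theory Num.Theory.
Import numFieldNormedType.Exports.

Local Open Scope classical_set_scope.
Local Open Scope ring_scope.

Section MetricNotions.
Context {R : realType} {M : metricType R}.
Implicit Types (A H : set M) (x : M) (r : R).

(* Real-valued [sup] and [inf]: below, [diam] is only applied to compact sets
   and [set_dist] to nonempty ones, so that the default values of [sup] and
   [inf] play no role. *)
Definition diam A : R := sup [set mdist p.1 p.2 | p in A `*` A].

Definition set_dist x A : R := inf [set mdist x y | y in A].

Definition packing A r H : Prop :=
  H `<=` A /\ trivIset H (fun y => ball y r).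

Definition maximal_packing A r H : Prop :=
  packing A r H /\ A `<=` \bigcup_(y in H) ball y (2 * r).

End MetricNotions.

(* The elements of I^* are the nonempty sequences over I.  A family indexed by
   I^* is a function on [seq I] whose value at [::] is never used; every
   condition on a word [w] is guarded by [(1 <= size w)%N], and those on
   [parent w] by [(2 <= size w)%N]. *)
Definition parent (I : Type) (w : seq I) : seq I := take (size w).-1 w.

Section Moran.
Context {R : realType} {M : metricType R} {I : finType}.
Variable X : seq I -> set M.

Definition WCMC : Prop :=
  (forall w, (1 <= size w)%N -> compact (X w) /\ 0 < diam (X w)) /\
  exists2 D : R, 1 <= D &
  [/\ forall w, (2 <= size w)%N -> X w `<=` X (parent w),
      exists2 n, (1 <= n)%N &
        \big[Num.max/0]_(w : n.-tuple I) diam (X w) < D^-1,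
      forall v w, (1 <= size v)%N -> (1 <= size w)%N ->
        diam (X (v ++ w)) <= D * diam (X v) * diam (X w)
    & forall w, (2 <= size w)%N ->
        D^-1 * diam (X (parent w)) <= diam (X w)].

(* [mkseq u n.+1] is the initial segment of length n + 1 of the infinite
   word [u]. *)
Definition limit_set : set M :=
  [set x | exists u : nat -> I, \bigcap_n X (mkseq u n.+1) = [set x]].

Definition Zr (r : R) : set (seq I) :=
  [set w | [/\ (2 <= size w)%N, diam (X w) <= r & r < diam (X (parent w))]].

Definition Zxr (x : M) (r : R) : set (seq I) :=
  [set w | Zr r w /\ X w `&` ball x r !=set0].

Definition finite_clustering : Prop :=
  (ereal_sup [set limf_esup (fun r : R => counting (Zxr x r) : \bar R) 0^'+
             | x in limit_set] < +oo)%E.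

Definition ball_condition : Prop :=
  exists2 delta : R, 0 < delta < 1 &
  forall x, limit_set x ->
  exists2 rx : R, 0 < rx &
  forall r, 0 < r < rx ->
  exists p : seq I -> M,
    (forall w, Zxr x r w -> set_dist (p w) (X w) < r) /\
    trivIset (Zxr x r) (fun w => ball (p w) (delta * r)).

End Moran.

(* Main.v *)
(* (a) The points x_i of the ball condition are a (delta r)-packing of B(x, 3r);
   extended to a maximal one by Zorn's lemma, it has fewer than
   c (3 / delta)^alpha1 elements, uniformly in x and r.
   (b) Let N bound #Z(x,r).  For delta small, every B(y_i, r/2) with y_i in X_i
   has a (2 delta r)-packing with at least N elements.  A ball B(x_j, delta r)
   meets B(z, delta r) for at most one centre z of such a packing, so the x_i can
   be chosen greedily among the centres. *)
Require Import Defs.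
From HB Require Import structures.
From mathcomp Require Import all_boot all_order all_algebra.
From mathcomp Require Import all_classical all_reals all_analysis.
From mathcomp Require Import finmap ring lra.

Set Implicit Arguments.
Unset Strict Implicit.
Unset Printing Implicit Defensive.

Import Order.TTheory GRing.Theory Num.Theory.
Import numFieldNormedType.Exports.

Local Open Scope classical_set_scope.
Local Open Scope ring_scope.

(** * Cardinality bounds and greedy choice *)

Section Counting.
Context {K : realType}.

Lemma counting_le_nat (T : choiceType) (A : set T) (n : nat) (f : T -> nat) :
  set_fun A `I_n f -> set_inj A f -> (counting A <= n%:R%:E :> \bar K)%E.
Proof.
move=> fA fI; have An : (A #<= `I_n)%card.
  by have /injfunPex[g] := ex_intro2 _ _ f fA fI; exact: inj_card_le.
have finA : finite_set A := card_le_finite An (finite_II n).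
by rewrite /counting asboolT// lee_fin ler_nat geq_card_fset_set.
Qed.

Lemma le_counting_inj (T U : choiceType) (A : set T) (B : set U) (f : T -> U) :
  set_fun A B f -> set_inj A f -> (counting A <= counting B :> \bar K)%E.
Proof.
move=> fAB fI; rewrite [leRHS]/counting; case: asboolP => [finB|_]; last first.
  exact: leey.
have memB z : A z -> f z \in fset_set B.
  by move=> Az; rewrite in_fset_set//; apply: mem_set; exact: fAB.
(* The position of [f z] in the enumeration of the finite set [B] codes [z] injectively by a number
   below the size of [B]. *)
apply: (@counting_le_nat _ _ _ (fun z => index (f z) (fset_set B))).
  by move=> z Az; rewrite /= index_mem memB.
move=> y z /set_mem Ay /set_mem Az /(congr1 (nth (f y) (fset_set B))).
by rewrite !nth_index ?memB// => /fI; apply; exact: mem_set.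
Qed.

(* A point [u] excludes at most one candidate of each [H w], so when choosing
   the points one by one there is always a candidate left. *)
Lemma greedy_selection (T : eqType) (U : choiceType) (C : U -> U -> Prop)
    (H : T -> set U) (u0 : U) (s : seq T) :
  (forall u v, C u v -> C v u) ->
  (forall w u a b, w \in s -> H w a -> H w b -> C u a -> C u b -> a = b) ->
  (forall w, w \in s -> ((size s)%:R%:E <= counting (H w) :> \bar K)%E) ->
  exists p : T -> U, (forall w, w \in s -> H w (p w)) /\
    (forall v w, v \in s -> w \in s -> C (p v) (p w) -> v = w).
Proof.
move=> Csym; elim: s => [|w s IH] HC Hs; first by exists (fun=> u0).
have [||p [Hp Cp]] := IH.
- by move=> v u a b vs; apply: HC; rewrite inE vs orbT.
- move=> v vs; apply: le_trans (Hs v _); last by rewrite inE vs orbT.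
  by rewrite lee_fin ler_nat.
(* The list may have repetitions; a repeated element keeps the point already chosen. *)
have [ws|ws] := boolP (w \in s).
  have sub v : v \in w :: s -> v \in s by rewrite inE => /predU1P[->|].
  by exists p; split=> [v /sub|v v' /sub + /sub]; [exact: Hp|exact: Cp].
have [z [Hz Cz]] : exists z, H w z /\ forall v, v \in s -> ~ C (p v) z.
  apply: contrapT => noz.
  (* If every candidate [z] is excluded, let [g z] in [s] be an element whose point excludes it. By
     [HC], [g] is injective on [H w], which then has at most [size s] elements. *)
  have /choice[g gP] : forall z, exists v, H w z -> v \in s /\ C (p v) z.
    move=> z; have [Hz|nHz] := pselect (H w z); last by exists w.
    apply: contrapT => nov; apply: noz; exists z; split=> // v vs Cv.
    by apply: nov; exists v.
  have : ((size s).+1%:R%:E <= (size s)%:R%:E :> \bar K)%E.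
    apply: le_trans (Hs w (mem_head _ _)) _.
    apply: (@counting_le_nat _ _ _ (fun z => index (g z) s)).
      by move=> z /gP[gs _]; rewrite /= index_mem.
    move=> y z /set_mem Hy /set_mem Hz /(congr1 (nth w s)).
    have [gys Cy] := gP _ Hy; have [gzs Cz] := gP _ Hz.
    rewrite !nth_index// => gyz.
    by apply: (HC w (p (g y))); rewrite ?mem_head// gyz.
  by rewrite lee_fin ler_nat ltnn.
exists (fun v => if v == w then z else p v); split.
  by move=> v; rewrite inE; case: eqP => [->|_ /=]; last exact: Hp.
move=> v v'; rewrite !inE.
case: eqP => [->|_] /=; case: eqP => [->|_] //= vs v's.
- by move=> /Csym /(Cz _ v's).
- by move=> /(Cz _ vs).
- exact: Cp.
Qed.

End Counting.

(** * Upper limits along a filter *)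

Section UpperLimit.
Context {K : realType} {T : choiceType} {U : filteredType T}.
Implicit Types (F : set_system U) (f : U -> \bar K) (a : \bar K).

(** The upper limit is the infimum of the suprema of [f] over the members of [F], and the set where
    [f x <= a] is a member. *)
Lemma limf_esup_le F f a :
  (\forall x \near F, (f x <= a)%E) -> (limf_esup f F <= a)%E.
Proof.
move=> Fa; rewrite limf_esupE.
apply: le_trans (ereal_inf_lbound _) _; first by exists [set x | (f x <= a)%E].
by apply: ge_ereal_sup => _ [x xa <-].
Qed.

Lemma limf_esup_lt F f a : Filter F ->
  (limf_esup f F < a)%E -> \forall x \near F, (f x < a)%E.
Proof.
move=> FF; rewrite limf_esupE => /ereal_inf_lt[_ [V FV <-] Va].
apply: filterS FV => x Vx; apply: le_lt_trans Va.
by apply: ereal_sup_ubound; exists x.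
Qed.

End UpperLimit.

(** * Packings and distances *)

Section Metric.
Context {K : realType} {M : metricType K}.
Implicit Types (A P H : set M) (x y z p : M) (r : K).

Lemma ball_meet y z r :
  ball y r `&` ball z r !=set0 -> ball y (2 * r) z.
Proof.
move=> [u [yu zu]]; rewrite mulr_natl mulr2n.
by apply: ball_triangle yu _; exact: ball_sym.
Qed.

(** Let [E] be a maximal disjoint family among the balls centred in [A] that miss those of [P]. By
    [ball_meet], a point of [A] outside all doubled balls could be added to [E]. *)
Lemma packing_maximal_extension A r P : 0 < r -> packing A r P ->
  exists2 H, P `<=` H & maximal_packing A r H.
Proof.
move=> r0 [PA tP].
pose B y := ball y r.
pose D := [set y | A y /\ forall z, P z -> ~ (B y `&` B z !=set0)].
have [E [ED tE maxE]] := ex_maximal_disjoint_subcollection B D.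
exists (P `|` E); first exact: subsetUl.
split; first split.
- by move=> y [/PA|/ED[]].
- move=> y z [Py|Ey] [Pz|Ez] yz; [exact: tP| | |exact: tE].
  + by case: ((ED _ Ez).2 y Py); rewrite setIC.
  + by case: ((ED _ Ey).2 z Pz).
- move=> a Aa; apply: contrapT => na.
  have far y : (P `|` E) y -> ~ (B a `&` B y !=set0).
    move=> PEy aB; apply: na; exists y => //.
    by apply: ball_meet; rewrite setIC.
  apply: (maxE (a |` E)).
  + split=> [|/(_ a (or_introl erefl)) Ea]; first exact: subsetUr.
    by apply: (far a); [right|exists a; split; exact: ballxx].
  + move=> y [->|/ED//]; split=> // z Pz; apply: far; left; exact: Pz.
  + move=> y z [->|Ey] [->|Ez] // yz; last exact: tE.
    * by case: (far z _ yz); right.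
    * by case: (far y); [right|rewrite setIC].
Qed.

(* No boundedness hypothesis: [sup] is [0] on sets without a supremum. *)
Lemma mdist_le_diam A y z : 0 < diam A -> A y -> A z -> mdist y z <= diam A.
Proof.
move=> A0 Ay Az; apply: ub_le_sup; last by exists (y, z).
have [[]//|/sup_out E] :=
  pselect (has_sup [set mdist p.1 p.2 | p in A `*` A]).
by move: A0; rewrite /diam E ltxx.
Qed.

Lemma set_dist_le p A y : A y -> set_dist p A <= mdist p y.
Proof.
move=> Ay; apply: ge_inf; last by exists y.
by exists 0 => _ [z _ <-]; exact: mdist_ge0.
Qed.

(** The path from [x] to [p] through two points of [A] has three steps, each of length at most
    [r]. *)
Lemma near_piece_ball x p A r : 0 < diam A -> diam A <= r ->
  A `&` ball x r !=set0 -> set_dist p A < r -> ball x (3 * r) p.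
Proof.
move=> A0 Ar [z [Az xz]] /inf_lt[|_ [y Ay <-] py].
  by exists (mdist p z), z.
rewrite !ballEmdist /= in xz *.
have yz := le_trans (mdist_le_diam A0 Az Ay) Ar.
have := metric_triangle x z p; have := metric_triangle z y p.
rewrite (metric_sym y p).
lra.
Qed.

End Metric.

Theorem proposition3p5 (K : realType) (M : metricType K) (I : finType)
    (hI : (2 <= #|I|)%N) (X : seq I -> set M) (hX : WCMC X)
    (c r0 alpha1 alpha2 : K) (hc : 0 < c) (hr0 : 0 < r0)
    (halpha2 : 0 < alpha2) (halpha : alpha2 <= alpha1) :
  ((forall (x : M) (r R : K), 0 < r -> r < R -> R < r0 ->
      forall H : set M, maximal_packing (ball x R) r H ->
      (counting H < (c * (R / r) `^ alpha1)%:E)%E) ->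
    ball_condition X -> finite_clustering X) /\
  ((forall (x : M) (r R : K), 0 < r -> r < R -> R < r0 ->
      forall H : set M, maximal_packing (ball x R) r H ->
      ((c^-1 * (R / r) `^ alpha2)%:E < counting H)%E) ->
    finite_clustering X -> ball_condition X).
Proof.
have X0 w x r : Zxr X x r w -> 0 < diam (X w).
  by move=> [[w2 _ _] _]; apply: (hX.1 _ _).2; exact: ltnW.
split=> hpack.

  (* From the ball condition to finite clustering *)
  move=> [delta /andP[d0 d1] hball].
  apply: (@le_lt_trans _ _ (c * (3 / delta) `^ alpha1)%:E); last exact: ltry.
  apply: ge_ereal_sup => _ [x Ex <-].
  apply: limf_esup_le.
  have [rx rx0 hx] := hball x Ex.
  near=> r.
  have r0' : 0 < r by near: r; exact: nbhs_right_gt.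
  have rrx : r < rx by near: r; exact: nbhs_right_lt.
  have r3 : 3 * r < r0.
    have : r < r0 / 3 by near: r; apply: nbhs_right_lt; rewrite divr_gt0.
    lra.
  have [|p [pX tp]] := hx r; first by rewrite r0'.
  have dr0 : 0 < delta * r by rewrite mulr_gt0.
  (* Injectivity lets the number of centres bound the number of words. *)
  have pI : set_inj (Zxr X x r) p.
    move=> v w /set_mem Zv /set_mem Zw pvw; apply: tp => //.
    by exists (p v); split; [|rewrite pvw]; exact: ballxx.
  have packp : packing (ball x (3 * r)) (delta * r) (p @` Zxr X x r).
    split; last exact: trivIset_image.
    move=> _ [w Zw <-]; apply: (near_piece_ball (X0 _ _ _ Zw)) (pX _ Zw).
    - by case: Zw => [[]].
    - by case: Zw.
  have [H pH maxH] := packing_maximal_extension dr0 packp.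
  apply: (@le_trans _ _ (counting H)).
    by apply: (le_counting_inj (f := p)) => // w Zw; apply: pH; exists w.
  have dr3 : delta * r < 3 * r by rewrite ltr_pM2r//; lra.
  have := ltW (hpack x _ _ dr0 dr3 r3 H maxH).
  by rewrite -mulf_div divff ?mulr1// gt_eqF.

(* From finite clustering to the ball condition *)
move=> fin.
(* One bound serves all [x], so [delta] will not depend on [x]. Since [a] is nonnegative, raising
   [c * a] to the power [alpha2^-1] and then [alpha2] gives it back. *)
have [a [a0 aP]] : exists a : K, 0 <= a /\ forall x, limit_set X x ->
    (limf_esup (fun r : K => counting (Zxr X x r) : \bar K) 0^'+ < a%:E)%E.
  move: fin; rewrite /finite_clustering; set S := ereal_sup _ => finS.
  have [a [a0 Sa]] : exists a : K, 0 <= a /\ (S < a%:E)%E.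
    case: S finS => [s _| |_] //; last by exists 0; rewrite ltNyr.
    exists (`|s| + 1); split; first by rewrite addr_ge0.
    by rewrite lte_fin ltr_pwDr// ler_norm.
  exists a; split=> // x Ex; apply: le_lt_trans Sa.
  by apply: ereal_sup_ubound; exists x.
(* With [delta = 1 / (4 t)], packing the ball of radius [r / 2] at scale
   [2 delta r] has ratio of radii [t], hence at least [a] elements. *)
pose t := 2 + (c * a) `^ alpha2^-1.
(* The summand 2 ensures [delta < 1] and a packing radius below [r / 2]. *)
have t2 : 2 <= t by rewrite lerDl powR_ge0.
have t0 : 0 < t by lra.
have ta : a <= c^-1 * t `^ alpha2.
  rewrite -ler_pdivrMl ?invr_gt0// invrK.
  have ca0 : 0 <= c * a by rewrite mulr_ge0// ltW.
  have := @ge0_ler_powR _ alpha2 (ltW halpha2) ((c * a) `^ alpha2^-1) t.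
  rewrite -powRrM mulVf ?gt_eqF// powRr1//; apply.
  - by rewrite nnegrE powR_ge0.
  - by rewrite nnegrE ltW.
  - by rewrite lerDr.
pose delta := (4 * t)^-1.
exists delta.
  by rewrite invr_gt0 mulr_gt0//= invf_lt1 ?mulr_gt0//; lra.
move=> x Ex.
have [e /= e0 He] := limf_esup_lt _ (aP x Ex).
exists (Num.min e r0); first by rewrite lt_min e0.
move=> r /andP[r0']; rewrite lt_min => /andP[re rr0].
have {He} : (counting (Zxr X x r) < a%:E :> \bar K)%E.
  by apply: He => //=; rewrite sub0r normrN gtr0_norm.
(* A count below a real number is not [+oo], so the set is finite and [s] can list it. *)
rewrite /counting; case: asboolP => [finZ|//]; rewrite lte_fin => Za.
set s : seq (seq I) := fset_set _ in Za.
have sP w : w \in s <-> Zxr X x r w.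
  by rewrite in_fset_set//; split => [/set_mem|/mem_set].
have rho0 : 0 < 2 * (delta * r) by rewrite !mulr_gt0// invr_gt0 mulr_gt0.
have rhoE : r / 2 / (2 * (delta * r)) = t.
  by rewrite /delta; field; rewrite !gt_eqF.
have rhoR : 2 * (delta * r) < r / 2.
  by rewrite -[ltLHS]mul1r -ltr_pdivlMr// rhoE; lra.
have /choice[H HP] : forall w, exists H : set M, w \in s ->
    [/\ trivIset H (fun y => ball y (2 * (delta * r))),
      forall y, H y -> set_dist y (X w) < r &
      ((size s)%:R%:E <= counting H :> \bar K)%E].
  move=> w; have [/sP[_ [y [Xy _]]]|] := boolP (w \in s); last by exists set0.
  (* Extending the empty packing yields a maximal one, with centres within [r / 2] of the point [y]
     of [X w]. *)
  have pack0 : packing (ball y (r / 2)) (2 * (delta * r)) set0.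
    by split=> // ? ? [].
  have [H _ maxH] := packing_maximal_extension rho0 pack0.
  exists H => _; have [[HA tH] _] := maxH; split=> //.
    move=> z /HA; rewrite ballEmdist /= metric_sym => zy.
    by apply: le_lt_trans (set_dist_le _ Xy) _; lra.
  apply: le_trans (ltW (hpack y _ _ rho0 rhoR _ H maxH)); last by lra.
  by rewrite rhoE lee_fin (le_trans (ltW Za)).
pose C (u v : M) := ball u (delta * r) `&` ball v (delta * r) !=set0.
have [|||p [pH Cp]] := @greedy_selection K _ _ C H x s.
- by move=> u v; rewrite /C setIC.
(* If the ball of [u] meets those of [y] and [z], then [u] lies in both doubled balls, which are
   disjoint for distinct centres. *)
- move=> w u y z /HP[tH _ _] Hy Hz uy uz; apply: tH => //; exists u.
  by split; apply: ball_meet; rewrite setIC.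
- by move=> w /HP[].
exists p; split=> [w /sP ws|v w /sP vs /sP ws]; last exact: Cp.
by have [_ + _] := HP _ ws; apply; exact: pH.
Unshelve. all: by end_near.
Qed.
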